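(* Let $L>0$, $T>0$ and $s\in[0,1]$. There is a constant $\tilde c_0>0$ independent of $h$ such that the following holds for every mesh $\Sigma_h$ of $\Sigma$ with maximal meshwidth $h$. Let $g\in L^2(\Sigma)$ be such that the exact solution $z$ of $(-\frac12\mathsf{Id}+\mathsf{K})z=g$ belongs to $H^s_{0,}(\Sigma)$, and let $z_h^0\in\mathcal{S}^0(\Sigma_h)$ be the Galerkin solution of $$\left(\left(-\tfrac12\mathsf{Id}+\mathsf{K}\right)z_h^0,q_h\right)_{L^2(\Sigma)}=(g,q_h)_{L^2(\Sigma)}\quad\text{for all }q_h\in\mathcal{S}^0(\Sigma_h).$$ Then $$\|z-z_h^0\|_{L^2(\Sigma)}\le\tilde c_0\,h^s\,\|z\|_{H^s(\Sigma)}.$$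
   Context: $\Gamma=\{0,L\}$, $\Sigma=\Gamma\times[0,T]$. A function on $\Sigma$ is a pair $v=(v_0,v_L)=(v(0,\cdot),v(L,\cdot))$ of functions on $(0,T)$; $L^2(\Sigma)=L^2(0,T)\times L^2(0,T)$ and $H^s(\Sigma)=H^s(0,T)\times H^s(0,T)$. $H^1_{0,}(\Sigma)=\{v: v_0,v_L\in H^1(0,T),\ v_0(0)=v_L(0)=0\}$ with norm $\|\partial_t v\|_{L^2(\Sigma)}$; $H^0_{0,}(\Sigma)=L^2(\Sigma)$; for $s\in(0,1)$, $H^s_{0,}(\Sigma)$ is the Hilbert interpolation space of order $s$ between $L^2(\Sigma)$ (order $0$) and $H^1_{0,}(\Sigma)$ (order $1$). $\mathsf{Id}$ is the identity and $\mathsf{K}$ is the double layer operator of the one-dimensional wave equation: $\mathsf{K}v(0,t)=-\tfrac12 v(L,t-L)$, $\mathsf{K}v(L,t)=-\tfrac12 v(0,t-L)$, where functions on $\Sigma$ are extended by zero to times $t\le0$. A mesh $\Sigma_h=\Sigma_h^0\cup\Sigma_h^L$ of $\Sigma$ with maximal meshwidth $h$ consists of a partition $\Sigma_h^0$ of $\{0\}\times(0,T)$ and a partition $\Sigma_h^L$ of $\{L\}\times(0,T)$ into finitely many non-overlapping intervals. $\mathcal{S}^0(\Sigma_h)\subset L^2(\Sigma)$ is the space of functions that are piecewise constant with respect to $\Sigma_h$. *)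

(* Defs.v *)
From HB Require Import structures.
From mathcomp Require Import all_boot all_order all_algebra.
From mathcomp Require Import all_classical all_reals all_analysis.
Set Implicit Arguments.
Unset Strict Implicit.
Unset Printing Implicit Defensive.
Import Order.TTheory GRing.Theory Num.Theory.
Import numFieldNormedType.Exports.

Local Open Scope classical_set_scope.
Local Open Scope ring_scope.

(* A function on (0,T) is represented by a function R -> R, of which only the
   values on (0,T) matter.  A function v on Sigma is the pair (v_0, v_L) of its
   values at the two ends. *)

Local Notation mu := lebesgue_measure.
Local Notation I T := (`]0%R, T[%classic : set _).

Definition fSigma (R : realType) : zmodType := ((R -> R) * (R -> R))%type.

Section Lebesgue.
Context {R : realType}.
Implicit Types (T : R) (f : R -> R) (u v : fSigma R).

(* L^2(0,T) and its norm through the extension of f by zero to the real line *)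
Definition L2 T : set (R -> R) :=
  [set f | f \_ (I T) \in Lfun mu 2%:E].

Definition L2norm T f : \bar R :=
  ('N[mu]_2%:E [EFin \o (f \_ (I T))])%E.

Definition L2S T : set (fSigma R) := [set v | L2 T v.1 /\ L2 T v.2].

Definition L2normS T v : \bar R :=
  ((L2norm T v.1 ^+ 2 + L2norm T v.2 ^+ 2) `^ 2^-1)%E.

Definition innerS T u v : R :=
  (\int[mu]_(t in I T) (u.1 t * v.1 t)) +
  (\int[mu]_(t in I T) (u.2 t * v.2 t)).

(* equality in L^2(Sigma) *)
Definition eqS T u v : Prop :=
  (u.1 = v.1 %[ae mu in I T]) /\ (u.2 = v.2 %[ae mu in I T]).

End Lebesgue.

Section Sobolev.
Context {R : realType}.
Implicit Types (T s t : R) (f w phi : R -> R) (v : fSigma R).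

(* C^1 functions with compact support in (0,T) *)
Definition test_function T phi : Prop :=
  [/\ forall x, derivable phi x 1,
      continuous (derive1 phi) &
      exists a b, [/\ 0 < a, b < T & forall x, x \notin `[a, b] -> phi x = 0]].

Definition is_weak_derivative T f w : Prop :=
  L2 T w /\ forall phi, test_function T phi ->
    \int[mu]_(t in I T) (f t * derive1 phi t) =
    - (\int[mu]_(t in I T) (w t * phi t)).

Definition H1 T : set (R -> R) :=
  [set f | L2 T f /\ exists w, is_weak_derivative T f w].

(* The weak derivative, unique up to a.e. equality; meaningful on H1 only. *)
Definition weak_derivative T f : R -> R :=
  xget (fun=> 0) [set w | is_weak_derivative T f w].

(* f(0) is the value at 0 of the continuous representative of f. *)
Definition vanishes_at0 T f : Prop :=
  exists fc : R -> R, [/\ {within `[0, T], continuous fc},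
                          f = fc %[ae mu in I T] & fc 0 = 0].

Definition H10S T : set (fSigma R) :=
  [set v | [/\ H1 T v.1, H1 T v.2, vanishes_at0 T v.1 & vanishes_at0 T v.2]].

Definition H10normS T v : \bar R :=
  L2normS T (weak_derivative T v.1, weak_derivative T v.2).

(* Slobodeckij seminorm, squared; the integrand is 0 on the diagonal. *)
Definition slobodeckij2 T s f : \bar R :=
  (\int[mu]_(x in I T) \int[mu]_(y in I T)
     (`|f x - f y| ^+ 2 / `|x - y| `^ (1 + 2 * s))%:E)%E.

(* Norm of H^s(0,T), 0 <= s <= 1; for 0 < s < 1 it is +oo outside H^s(0,T). *)
Definition Hsnorm T s f : \bar R :=
  if s == 0 then L2norm T f
  else if s == 1 then
    ((L2norm T f ^+ 2 + L2norm T (weak_derivative T f) ^+ 2) `^ 2^-1)%E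
  else ((L2norm T f ^+ 2 + slobodeckij2 T s f) `^ 2^-1)%E.

Definition HsnormS T s v : \bar R :=
  ((Hsnorm T s v.1 ^+ 2 + Hsnorm T s v.2 ^+ 2) `^ 2^-1)%E.

End Sobolev.

Section Interpolation.
Context {R : realType} {V : zmodType}.
Variables (X0 X1 : set V) (n0 n1 : V -> \bar R).

(* The K-functional in its quadratic form, squared:
   K(t,v)^2 = inf_{v = v0 + v1} |v0|_0^2 + t^2 |v1|_1^2. *)
Definition Kfun2 (t : R) (v : V) : \bar R :=
  ereal_inf [set x : \bar R | exists v0 v1, [/\ X0 v0, X1 v1, v = v0 + v1 &
    x = (n0 v0 ^+ 2 + (t ^+ 2)%:E * n1 v1 ^+ 2)%E]].

(* The Hilbert interpolation space of order 0 < s < 1 between X0 and X1, where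
   X1 is a subset of X0: int_0^oo t^(-1-2s) K(t,v)^2 dt is finite. *)
Definition interpolation_space (s : R) : set V :=
  [set v | X0 v /\
    (\int[mu]_(t in `]0%R, +oo[)
       ((t `^ (- (1 + 2 * s)))%:E * Kfun2 t v) < +oo)%E].

End Interpolation.

Definition Hs0S {R : realType} (T s : R) : set (fSigma R) :=
  if s == 0 then L2S T
  else if s == 1 then H10S T
  else interpolation_space (L2S T) (H10S T) (L2normS T) (H10normS T) s.

Section Operators.
Context {R : realType}.
Implicit Types (L : R) (v : fSigma R).

Definition extend0 (f : R -> R) (t : R) : R := if 0 < t then f t else 0.

Definition Kop L v : fSigma R :=
  ((fun t => - 2^-1 * extend0 v.2 (t - L)),
   (fun t => - 2^-1 * extend0 v.1 (t - L))).

(* -1/2 Id + K *)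
Definition Aop L v : fSigma R :=
  ((fun t => - 2^-1 * v.1 t + (Kop L v).1 t),
   (fun t => - 2^-1 * v.2 t + (Kop L v).2 t)).

End Operators.

Section Mesh.
Context {R : realType}.
Implicit Types (T : R) (p : seq R).

(* A partition 0 < p_0 < ... < p_(n-1) = T of (0,T) is given by the sequence p
   of its nodes other than 0, subject to itv_partition 0 T p. *)
Definition left_node p (i : nat) : R := nth 0 (0 :: p) i.
Definition right_node p (i : nat) : R := nth 0 p i.

Definition meshwidth p : R :=
  \big[Num.max/0]_(i < size p) (right_node p i - left_node p i).

Definition piecewise_constant p (f : R -> R) : Prop :=
  forall i, (i < size p)%N -> exists c : R,
    forall t, left_node p i < t < right_node p i -> f t = c.

Definition meshwidthS p0 pL : R := Num.max (meshwidth p0) (meshwidth pL).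

Definition S0S T p0 pL : set (fSigma R) :=
  [set v | [/\ L2S T v, piecewise_constant p0 v.1 & piecewise_constant pL v.2]].

End Mesh.

(* Main.v *)
Require Import Defs.
From HB Require Import structures.
From mathcomp Require Import all_boot all_order all_algebra.
From mathcomp Require Import all_classical all_reals all_analysis.
From mathcomp Require Import measurable_realfun ring lra.

(** The operator -1/2 Id + K equals -1/2 B with B = Id + S, where S exchanges
    the two ends of the spatial interval and delays by the travel time L.  Two
    properties of S on L^2(Sigma) give everything: it is a contraction, because
    translations preserve Lebesgue measure ([delay_contraction]), and it is
    nilpotent, because after m delays with m L >= T nothing is left on (0,T)
    ([innerS_iter_delay_eq0]).

    Quasi-optimality ([quasi_optimality]).  From |Sv| <= |v| one gets
    (Bv, v) >= 1/2 |Bv|^2.  From nilpotency, B is invertible by a finite Neumann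
    series, so |v|^2 <= C |Bv|^2 ([id_plus_delay_bounded_below]), with C
    depending on the number of delays only, that is on T / L.  Let e = z - z_h
    be the Galerkin error and r = z - q with q piecewise constant.  Galerkin
    orthogonality says (Be, e) = (Be, r), and expanding 0 <= |Be - 2r|^2 turns
    this into |Be|^2 <= 4 |r|^2.  Hence |e|^2 <= 4 C |r|^2.

    Approximation ([piecewise_constant_approximation]).  It remains to choose q
    with |z - q| <= h^s |z|_{H^s}, separately for the two components of z.
    Everything is reduced to one interval (a,b) of the mesh: there is an energy
    density G >= 0, whose integral over (0,T) is at most the squared H^s norm of
    f, such that on each (a,b) some constant c satisfies
    |f - c|^2 <= (b - a)^(2s) (integral of G over (a,b)), see [local_energy].
    Adding these bounds over the mesh gives the claim.
    - For s = 0, take G = f^2 and c = 0.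
    - For 0 < s < 1, G is the inner integral of the Slobodeckij double integral.
      At some y in (a,b) the density G is at most its average over (a,b), and
      c = f(y) works, as |x - y| <= b - a ([slobodeckij_local]).
    - For s = 1, G is the square of the weak derivative w.  Testing the
      definition of w with a smoothed indicator function of (x,y) shows that the
      continuous representative g of f satisfies
      |g(x) - g(y)|^2 <= (b - a) (integral of w^2 over (a,b)),
      see [weak_derivative_hoelder]; c is the value of g at the midpoint. *)

Set Implicit Arguments.
Unset Strict Implicit.
Unset Printing Implicit Defensive.
Import Order.TTheory GRing.Theory Num.Theory.
Import numFieldNormedType.Exports.

Local Open Scope classical_set_scope.
Local Open Scope ring_scope.

Local Notation mu := lebesgue_measure.
Local Notation I T := (`]0%R, T[%classic : set _).

(** * Square-integrable functions on (0,T) and on Sigma *)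

Section SquareIntegrable.
Context {R : realType}.
Implicit Types (T : R) (f g : R -> R) (u v w : fSigma R).

Lemma poweR2 (x : \bar R) : (0 <= x)%E -> (x `^ 2 = x ^+ 2)%E.
Proof.
case: x => [x|_|//]; last by rewrite poweRyr ?pnatr_eq0// expeS mulyy.
by rewrite lee_fin => x0; rewrite poweR_EFin powR_mulrn// EFin_expe.
Qed.

Lemma sqr_poweR_inv2 (x : \bar R) : (0 <= x)%E -> ((x `^ 2^-1) ^+ 2 = x)%E.
Proof.
by move=> x0; rewrite poweR12_sqrt// sqr_sqrte.
Qed.

Lemma L2norm_ge0 T f : (0 <= L2norm T f)%E.
Proof. exact: Lnorm_ge0. Qed.

Lemma L2norm_sq T f :
  (L2norm T f ^+ 2 = \int[mu]_(t in I T) (f t ^+ 2)%:E)%E.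
Proof.
rewrite -poweR2 ?Lnorm_ge0// poweR_Lnorm ?pnatr_eq0//.
rewrite [RHS]integral_mkcond; apply: eq_integral => x _ /=.
rewrite /patch; case: ifP => _; last by rewrite normr0 powR0// pnatr_eq0.
by rewrite powR_mulrn ?normr_ge0// real_normK ?num_real.
Qed.

(** Removes the extension by zero to the real line from the definition of
    [L2], so that all later arguments stay inside (0,T). *)
Lemma L2P T f : L2 T f <-> measurable_fun (I T) f /\
  mu.-integrable (I T) (EFin \o (fun t => f t ^+ 2)).
Proof.
split.
- rewrite /L2 /= => Lf; split.
    move: Lf; rewrite inE => /andP[]; rewrite inE/= => mf _.
    by apply/measurable_restrictT.
  have := Lfun2_integrable_sqr Lf.
  rewrite [X in _ -> X]integrable_mkcond//.
  apply: eq_integrable => // x _ /=; rewrite /patch.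
  by case: ifP => _ //=; rewrite expr0n.
- move=> [mf /integrable_lty fin]; rewrite /L2 /= inE.
  apply/andP; split; rewrite inE/=; first exact: (measurable_restrictT f _).1.
  rewrite /finite_norm -[X in (X < _)%E]/(L2norm T f).
  apply: (@lty_poweRy _ _ 2); first by rewrite pnatr_eq0.
  by rewrite poweR2 ?L2norm_ge0// L2norm_sq; exact: fin.
Qed.

Lemma L2_measurable T f : L2 T f -> measurable_fun (I T) f.
Proof. by move=> /L2P[]. Qed.

Lemma L2_integrable_sq T f : L2 T f ->
  mu.-integrable (I T) (EFin \o (fun t => f t ^+ 2)).
Proof. by move=> /L2P[]. Qed.

Lemma L2_integrableM T f g : L2 T f -> L2 T g ->
  mu.-integrable (I T) (EFin \o (fun t => f t * g t)).
Proof.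
move=> /= Lf Lg; have := Lfun2_mul_Lfun1 Lf Lg => /Lfun1_integrable.
rewrite [X in _ -> X]integrable_mkcond//.
apply: eq_integrable => // x _ /=; rewrite /patch.
by case: ifP => _ //=; rewrite mulr0.
Qed.

Lemma lebesgue_measure_oo (a b : R) : a < b ->
  mu (`]a, b[%classic : set R) = (b - a)%:E.
Proof. by move=> ab; rewrite lebesgue_measure_itv/= lte_fin ab EFinD. Qed.

Lemma measure_itv_lty (a b : R) : (mu `]a, b[%classic < +oo)%E.
Proof. by rewrite lebesgue_measure_itv; case: ifP; rewrite ltry. Qed.

Lemma L2_bounded T f (M : R) : measurable_fun (I T) f ->
  (forall t, I T t -> `|f t| <= M) -> L2 T f.
Proof.
move=> mf fM; apply/L2P; split => //.
apply: measurable_bounded_integrable => //; first exact: measure_itv_lty.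
  exact: measurable_funX.
exists (M ^+ 2); split; first exact: num_real.
move=> x Mx t It /=; rewrite normrX (le_trans _ (ltW Mx))//.
by rewrite lerXn2r ?nnegrE ?(le_trans _ (fM _ It))// fM.
Qed.

Lemma L2D T f g : L2 T f -> L2 T g -> L2 T (fun t => f t + g t).
Proof.
move=> Lf Lg; have mf := L2_measurable Lf; have mg := L2_measurable Lg.
apply/L2P; split; first exact: measurable_funD.
have := integrableD _ (integrableD _ (L2_integrableM Lf Lf)
  (L2_integrableM Lf Lg)) (integrableD _ (L2_integrableM Lf Lg)
  (L2_integrableM Lg Lg)).
move=> /(_ (measurable_itv _) (measurable_itv _) (measurable_itv _)).
apply: eq_integrable => // t _ /=.
by rewrite -!EFinD; congr EFin; ring.
Qed.

Lemma L2N T f : L2 T f -> L2 T (fun t => - f t).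
Proof.
move=> /L2P[mf iF]; apply/L2P; split; first exact: measurableT_comp.
by apply: eq_integrable iF => // t _ /=; rewrite sqrrN.
Qed.

Lemma L2B T f g : L2 T f -> L2 T g -> L2 T (fun t => f t - g t).
Proof. by move=> Lf Lg; apply: L2D => //; exact: L2N. Qed.

Lemma L2S_B T u v : L2S T u -> L2S T v -> L2S T (u - v).
Proof. by move=> [? ?] [? ?]; split; exact: L2B. Qed.

Lemma L2S_D T u v : L2S T u -> L2S T v -> L2S T (u + v).
Proof. by move=> [? ?] [? ?]; split; exact: L2D. Qed.

Lemma innerSDl T u v w : L2S T u -> L2S T v -> L2S T w ->
  innerS T (u + v) w = innerS T u w + innerS T v w.
Proof.
move=> [u1 u2] [v1 v2] [w1 w2]; rewrite /innerS addrACA.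
congr (_ + _); rewrite -RintegralD//; try exact: L2_integrableM;
  by apply: eq_Rintegral => t _; rewrite mulrDl.
Qed.

Lemma innerSC T u v : innerS T u v = innerS T v u.
Proof.
by rewrite /innerS; congr (_ + _); apply: eq_Rintegral => t _; rewrite mulrC.
Qed.

Lemma innerS_ge0 T v : 0 <= innerS T v v.
Proof.
by rewrite addr_ge0// Rintegral_ge0// => t _; rewrite -expr2 sqr_ge0.
Qed.

Lemma innerSBl T u v w : L2S T u -> L2S T v -> L2S T w ->
  innerS T (u - v) w = innerS T u w - innerS T v w.
Proof.
move=> Lu Lv Lw; apply/eqP; rewrite eq_sym subr_eq -innerSDl ?subrK//.
exact: L2S_B.
Qed.

Lemma innerSDr T u v w : L2S T u -> L2S T v -> L2S T w ->
  innerS T w (u + v) = innerS T w u + innerS T w v.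
Proof. by move=> *; rewrite !(innerSC T w) innerSDl. Qed.

Lemma innerSBr T u v w : L2S T u -> L2S T v -> L2S T w ->
  innerS T w (u - v) = innerS T w u - innerS T w v.
Proof. by move=> *; rewrite !(innerSC T w) innerSBl. Qed.

Lemma innerSD_sq T u v : L2S T u -> L2S T v ->
  innerS T (u + v) (u + v) = innerS T u u + innerS T u v *+ 2 + innerS T v v.
Proof.
move=> Lu Lv; have Luv := L2S_D Lu Lv.
by rewrite innerSDl// !innerSDr// (innerSC T v u); ring.
Qed.

Lemma innerSB_sq T u v : L2S T u -> L2S T v ->
  innerS T (u - v) (u - v) = innerS T u u - innerS T u v *+ 2 + innerS T v v.
Proof.
move=> Lu Lv; have Luv := L2S_B Lu Lv.
by rewrite innerSBl// !innerSBr// (innerSC T v u); ring.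
Qed.

Lemma innerSB_sq_le T u v : L2S T u -> L2S T v ->
  innerS T (u - v) (u - v) <= innerS T u u *+ 2 + innerS T v v *+ 2.
Proof.
move=> Lu Lv; have := innerS_ge0 T (u + v).
by rewrite innerSB_sq// innerSD_sq//; lra.
Qed.

Lemma L2normS_sq T v : L2S T v -> (L2normS T v ^+ 2 = (innerS T v v)%:E)%E.
Proof.
move=> [L1 L2]; rewrite /L2normS sqr_poweR_inv2 ?adde_ge0 ?sqre_ge0//.
rewrite !L2norm_sq /innerS EFinD /Rintegral.
by rewrite !fineK//; apply: integrable_fin_num => //; exact: L2_integrableM.
Qed.

Lemma L2_Rintegral_ae T f g h : L2 T f -> L2 T g -> L2 T h ->
  f = g %[ae mu in I T] ->
  \int[mu]_(t in I T) (f t * h t) = \int[mu]_(t in I T) (g t * h t).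
Proof.
(* The hypothesis is folded into [ae_eq], on which the congruence lemmas act. *)
move=> Lf Lg Lh; rewrite -[X in X -> _]/(ae_eq mu (I T) f g) => fg.
congr fine; apply: ae_eq_integral => //;
  do ?[by apply: (@measurable_int _ _ _ mu); exact: L2_integrableM].
by apply: (ae_eq_comp EFin); exact: ae_eq_mul2r.
Qed.

Lemma innerS_ae T u v w : L2S T u -> L2S T v -> L2S T w -> eqS T u v ->
  innerS T u w = innerS T v w.
Proof.
by move=> [? ?] [? ?] [? ?] [? ?]; congr (_ + _); exact: L2_Rintegral_ae.
Qed.

Lemma L2_ae T f g : measurable_fun (I T) g -> f = g %[ae mu in I T] ->
  L2 T f -> L2 T g.
Proof.
move=> mg; rewrite -[X in X -> _]/(ae_eq mu (I T) f g) => fg.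
move=> /L2P[mf /integrableP[mf2 f2]]; apply/L2P; split => //.
apply/integrableP; split; first by apply/measurable_EFinP/measurable_funX.
rewrite (le_lt_trans _ f2)// le_eqVlt; apply/orP; left; apply/eqP.
apply: ge0_ae_eq_integral => //.
- by apply: measurableT_comp => //; apply/measurable_EFinP/measurable_funX.
- by apply: measurableT_comp.
- have gf : ae_eq mu (I T) g f by exact: ae_eq_sym.
  by have := ae_eq_comp (fun r => `|(r ^+ 2)%:E|%E) gf.
Qed.

Lemma L2Z T (c : R) f : L2 T f -> L2 T (fun t => c * f t).
Proof.
move=> /L2P[mf f2]; apply/L2P; split; first exact: measurable_funM.
have := integrableZl _ (c ^+ 2) f2 => /(_ (measurable_itv _)).
by apply: eq_integrable => // t _ /=; rewrite exprMn EFinM.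
Qed.

(** The integral of (f - x g)^2 is nonnegative for every x; x = P / l, with P the
    integral of f g, would be optimal if the integral of g^2 were equal to l.  An
    upper bound l > 0 instead of that integral avoids the case g = 0. *)
Lemma L2_cauchy_schwarz T f g (l : R) : 0 < l -> L2 T f -> L2 T g ->
  \int[mu]_(t in I T) (g t ^+ 2) <= l ->
  (\int[mu]_(t in I T) (f t * g t)) ^+ 2 <= l * \int[mu]_(t in I T) (f t ^+ 2).
Proof.
move=> l0 Lf Lg gl; set P := \int[mu]_(t in _) (f t * g t).
have iff := L2_integrable_sq Lf; have igg := L2_integrable_sq Lg.
have ifg := L2_integrableM Lf Lg.
have iZ (c : R) h : mu.-integrable (I T) (EFin \o h) ->
    mu.-integrable (I T) (EFin \o (fun t => c * h t)).
  move=> ih; have := integrableZl _ c ih => /(_ (measurable_itv _)).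
  by apply: eq_integrable => // t _ /=; rewrite EFinM.
have : 0 <= \int[mu]_(t in I T) ((f t - P / l * g t) ^+ 2).
  by apply: Rintegral_ge0 => t _; exact: sqr_ge0.
have -> : \int[mu]_(t in I T) ((f t - P / l * g t) ^+ 2) =
    \int[mu]_(t in I T) (f t ^+ 2) -
    (2 * (P / l)) * P + (P / l) ^+ 2 * \int[mu]_(t in I T) (g t ^+ 2).
  rewrite -!RintegralZl// -RintegralB//; last exact: iZ.
  rewrite -RintegralD//; last exact: iZ.
    by apply: eq_Rintegral => t _; ring.
  have := integrableB _ iff (iZ (2 * (P / l)) _ ifg).
  by move=> /(_ (measurable_itv _)); apply: eq_integrable.
move: gl; set G := Rintegral _ _ _; set F := Rintegral _ _ _ => gl.
have : (P / l) ^+ 2 * G <= (P / l) ^+ 2 * l by rewrite ler_wpM2l ?sqr_ge0.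
have -> : (P / l) ^+ 2 * l = P ^+ 2 / l by field; rewrite gt_eqF.
have -> : 2 * (P / l) * P = 2 * (P ^+ 2 / l) by field; rewrite gt_eqF.
by move=> ? ?; rewrite [_ * F]mulrC -ler_pdivrMr//; lra.
Qed.

End SquareIntegrable.

(** * The delay operator and quasi-optimality of the Galerkin solution *)

Section Delay.
Context {R : realType}.
Implicit Types (L T : R) (f : R -> R) (u v : fSigma R).

Lemma lebesgue_measure_translation L (A : set R) : measurable A ->
  pushforward mu ((fun t => t - L) : _ -> measurableTypeR R) A = mu A.
Proof.
move=> mA; apply/esym/lebesgue_measure_unique => //=.
  exact: (@measurable_funB _ _ R).
move=> mtr _ [[a b]] _ <-; rewrite /pushforward /=.
have -> : (fun t : R => t - L) @^-1` `]a, b]%classic = `]a + L, b + L]%classic.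
  by apply/seteqP; split => t /=; rewrite !in_itv/= ltrBrDr lerBlDr.
rewrite !lebesgue_measure_itv/= !lte_fin ltrD2r.
by case: ifP => // _; rewrite -!EFinD; congr EFin; ring.
Qed.

Lemma ge0_integral_translation L (F : R -> \bar R) :
  measurable_fun setT F -> (forall t, 0 <= F t)%E ->
  (\int[mu]_t F (t - L)%R = \int[mu]_t F t)%E.
Proof.
move=> mF F0; transitivity (\int[pushforward mu
    ((fun t => t - L)%R : _ -> measurableTypeR R)]_t F t)%E; last first.
  apply: eq_measure_integral; first exact: (@measurable_funB _ _ R).
  by move=> mtr A mA _; exact: lebesgue_measure_translation.
by rewrite ge0_integral_pushforward//; exact: measurable_funB.
Qed.

(** -1/2 Id + K is -1/2 times the sum of the identity and this operator. *)
Definition delay L v : fSigma R :=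
  ((fun t => extend0 v.2 (t - L)), (fun t => extend0 v.1 (t - L))).

Lemma extend0_restrict L T f t : 0 <= L -> I T t ->
  extend0 f (t - L) = (f \_ (I T)) (t - L).
Proof.
rewrite /= in_itv/= /extend0 /patch => L0 /andP[t0 tT].
case: ifPn => tL; first by rewrite mem_set//= in_itv/= tL ltrBlDr ltr_wpDr.
by rewrite memNset//= in_itv/= (negbTE tL).
Qed.

Lemma measurable_extend0 L T f : 0 <= L -> measurable_fun (I T) f ->
  measurable_fun (I T) (fun t => extend0 f (t - L)).
Proof.
move=> L0 mf; apply: (@eq_measurable_fun _ _ _ _ _ ((f \_ (I T)) \o
    (fun t => t - L))).
  by move=> t /[!inE] It; rewrite (extend0_restrict _ L0 It).
apply: measurable_funTS; apply: measurableT_comp; last exact: measurable_funB.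
exact: (measurable_restrictT f _).1.
Qed.

(** Translating by L preserves the integral over the whole line; what is
    translated beyond T is lost when restricting to (0,T) again. *)
Lemma integral_extend0_le L T f : 0 <= L -> measurable_fun (I T) f ->
  (\int[mu]_(t in I T) (extend0 f (t - L) ^+ 2)%:E <=
   \int[mu]_(t in I T) (f t ^+ 2)%:E)%E.
Proof.
move=> L0 mf; have mfI := (measurable_restrictT f (measurable_itv _)).1 mf.
have -> : (\int[mu]_(t in I T) (f t ^+ 2)%:E =
           \int[mu]_t ((f \_ (I T)) t ^+ 2)%:E)%E.
  rewrite integral_mkcond; apply: eq_integral => t _; rewrite /patch.
  by case: ifP => //; rewrite expr0n.
rewrite -(@ge0_integral_translation L (fun t => ((f \_ (I T)) t ^+ 2)%:E)).
- under eq_integral => t /[!inE] It do rewrite (extend0_restrict _ L0 It).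
  apply: ge0_subset_integral => //.
  + apply/measurable_EFinP/measurable_funX; apply: measurableT_comp => //.
    exact: measurable_funB.
  + by move=> t _; rewrite lee_fin sqr_ge0.
- by apply/measurable_EFinP/measurable_funX.
- by move=> t; rewrite lee_fin sqr_ge0.
Qed.

Lemma L2_extend0 L T f : 0 <= L -> L2 T f -> L2 T (fun t => extend0 f (t - L)).
Proof.
move=> L0 /L2P[mf iF]; have mS := measurable_extend0 L0 mf.
apply/L2P; split => //; apply/integrableP; split.
  by apply/measurable_EFinP/measurable_funX.
under eq_integral do rewrite /= ger0_norm ?sqr_ge0//.
exact: le_lt_trans (integral_extend0_le L0 mf) (integrable_lty _ iF).
Qed.

Lemma L2S_delay L T v : 0 <= L -> L2S T v -> L2S T (delay L v).
Proof. by move=> L0 [L1 L2]; split; exact: L2_extend0. Qed.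

Lemma delay_contraction L T v : 0 <= L -> L2S T v ->
  innerS T (delay L v) (delay L v) <= innerS T v v.
Proof.
move=> L0 Lv; have LS := L2S_delay L0 Lv.
rewrite -lee_fin -!L2normS_sq//.
rewrite /L2normS !sqr_poweR_inv2 ?adde_ge0 ?sqre_ge0// !L2norm_sq addeC.
by case: Lv => /L2_measurable m1 /L2_measurable m2; apply: leeD;
  exact: integral_extend0_le.
Qed.

Lemma delayD L u v : delay L (u + v) = delay L u + delay L v.
Proof.
have extendD f g t : extend0 (f + g) t = extend0 f t + extend0 g t :> R.
  by rewrite /extend0; case: ifP => // _; rewrite addr0.
by congr pair; apply/funext => t /=; exact: extendD.
Qed.

(** Each delay postpones by L the first time at which the function can be
    nonzero. *)
Lemma iter_delay0 L v m t : 0 <= L -> 0 < t <= m%:R * L ->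
  (iter m (delay L) v).1 t = 0 /\ (iter m (delay L) v).2 t = 0.
Proof.
move=> L0; elim: m t => [|m IH] t /andP[t0 tm].
  by move: t0; rewrite ltNge (le_trans tm)// mul0r.
rewrite iterS /= /extend0; case: ifP => // tL.
have [] := IH (t - L); last by move=> -> ->.
by rewrite tL lerBlDr (le_trans tm)// -natr1 mulrDl mul1r.
Qed.

Lemma innerS_iter_delay_eq0 L T v m : 0 <= L -> T <= m%:R * L ->
  innerS T (iter m (delay L) v) (iter m (delay L) v) = 0.
Proof.
move=> L0 Tm; have E t : I T t ->
    (iter m (delay L) v).1 t = 0 /\ (iter m (delay L) v).2 t = 0.
  rewrite /= in_itv/= => /andP[t0 tT]; apply: iter_delay0 => //.
  by rewrite t0 (le_trans (ltW tT)).
have int0 : \int[mu]_(t in I T) (0 : R) = 0 by rewrite Rintegral_cst// mul0r.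
transitivity (\int[mu]_(t in I T) (0 : R) + \int[mu]_(t in I T) (0 : R)).
  by congr (_ + _); apply: eq_Rintegral => t /[!inE] /E[e1 e2];
    rewrite ?e1 ?e2 mul0r.
by rewrite int0 addr0.
Qed.

(** A quantitative form of the finite Neumann series for the inverse of
    B = Id + S, with S the delay.  Induction on the nilpotency index: v = Bv - Sv,
    and Sv has a smaller index than v, so the induction hypothesis bounds |Sv| by
    |BSv| = |SBv| <= |Bv|. *)
Lemma id_plus_delay_bounded_below L T m : 0 <= L -> T <= m%:R * L ->
  exists C : R, 0 < C /\ forall v, L2S T v ->
    innerS T v v <= C * innerS T (v + delay L v) (v + delay L v).
Proof.
move=> L0 Tm.
suff H : forall k, exists C : R, 0 < C /\ forall v, L2S T v ->
    innerS T (iter k (delay L) v) (iter k (delay L) v) = 0 ->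
    innerS T v v <= C * innerS T (v + delay L v) (v + delay L v).
  have [C [C0 HC]] := H m; exists C; split => // v Lv.
  by apply: HC => //; exact: innerS_iter_delay_eq0.
elim => [|k [C [C0 HC]]].
  exists 1; split => // v Lv /= ->; rewrite mul1r; exact: innerS_ge0.
(* 2 + 2 C comes from |v|^2 <= 2 |Bv|^2 + 2 |Sv|^2 and |Sv|^2 <= C |Bv|^2. *)
exists (2 + 2 * C); split => [|v Lv vk]; first lra.
have LS : L2S T (delay L v) by exact: L2S_delay.
have LB : L2S T (v + delay L v) by exact: L2S_D.
have := HC _ LS; rewrite -iterSr vk => /(_ erefl).
rewrite -delayD => HS; have := delay_contraction L0 LB => HB.
have := innerSB_sq_le LB LS; rewrite addrK => HP.
have := ler_wpM2l (ltW C0) HB; lra.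
Qed.

(** Here e is the Galerkin error and e - r lies in the discrete space, so the
    hypothesis is Galerkin orthogonality.  The contraction property gives
    1/2 |Be|^2 <= (Be, e) = (Be, r), and 0 <= |Be - 2r|^2 bounds (Be, r) by
    1/4 |Be|^2 + |r|^2. *)
Lemma quasi_optimality L T : 0 < L -> 0 < T ->
  exists C : R, 0 < C /\ forall e r, L2S T e -> L2S T r ->
    innerS T (e + delay L e) (e - r) = 0 ->
    innerS T e e <= C * innerS T r r.
Proof.
move=> L0 T0; have [m Tm] : exists m : nat, T <= m%:R * L.
  exists (Num.bound (T / L)); rewrite -ler_pdivrMr// ltW//.
  by apply: archi_boundP; rewrite divr_ge0 ?ltW.
have [C [C0 HC]] := id_plus_delay_bounded_below (ltW L0) Tm.
exists (4 * C); split => [|e r Le Lr]; first lra.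
have LS := L2S_delay (ltW L0) Le; have LB := L2S_D Le LS.
rewrite innerSBr// => /eqP; rewrite subr_eq0 => /eqP Ber.
have coercive : innerS T (e + delay L e) (e + delay L e) <=
    innerS T (e + delay L e) e *+ 2.
  have := delay_contraction (ltW L0) Le.
  by rewrite innerSD_sq// innerSDl// (innerSC T (delay L e)); lra.
apply: le_trans (HC _ Le) _; rewrite (mulrC 4) -mulrA ler_pM2l//.
move: (e + delay L e) LB Ber coercive => B LB -> coercive.
have Lrr := L2S_D Lr Lr; have := innerS_ge0 T (B - (r + r)).
by rewrite innerSB_sq// innerSDr// innerSD_sq//; lra.
Qed.

End Delay.

(** * Integrals and step functions along a partition *)

Section Partition.
Context {R : realType}.
Implicit Types (c : nat -> R) (G : R -> \bar R) (p : seq R).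

Lemma ge0_integral_itv_split (a x b : R) G : a <= x <= b ->
  measurable_fun `]a, b[%classic G ->
  (forall t, t \in `]a, b[ -> 0 <= G t)%E ->
  (\int[mu]_(t in `]a, b[%classic) G t =
   \int[mu]_(t in `]a, x[%classic) G t + \int[mu]_(t in `]x, b[%classic) G t)%E.
Proof.
move=> /andP[ax]; rewrite le_eqVlt => /predU1P[->|xb] mG G0.
  by rewrite [X in (_ = _ + X)%E](_ : _ = 0%E) ?adde0// set_itvoo0 integral_set0.
have E : `]a, b[%classic = `]a, x]%classic `|` `]x, b[%classic :> set R.
  by rewrite -itv_bndbnd_setU// bnd_simp.
rewrite [in LHS]E ge0_integral_setU//.
- congr (_ + _)%E; rewrite integral_itv_bndo_bndc//; apply: measurable_funS mG => //.
  by apply: subset_itvl; rewrite bnd_simp ltW.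
- by rewrite -E.
- by move=> t; rewrite -E; exact: G0.
- apply/disj_setPS => t [/=]; rewrite !in_itv/= => /andP[_ tx] /andP[xt _].
  by move: xt; rewrite ltNge tx.
Qed.

Lemma ge0_integral_partition (a b : R) p G : itv_partition a b p ->
  measurable_fun `]a, b[%classic G ->
  (forall t, t \in `]a, b[ -> 0 <= G t)%E ->
  (\int[mu]_(t in `]a, b[%classic) G t =
   \sum_(i < size p)
     \int[mu]_(t in `]nth 0%R (a :: p) i, nth 0%R p i[%classic) G t)%E.
Proof.
elim: p a => [|x p IH] a ap mG G0.
  by rewrite (itv_partition_nil ap) big_ord0 set_itvoo0 integral_set0.
have ax : a < x by case: ap => /= /andP[].
have xp := itv_partition_cons ap; have xb := itv_partition_le xp.
rewrite big_ord_recl (@ge0_integral_itv_split a x b) ?(ltW ax)//.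
rewrite (IH x)//.
- apply: measurable_funS mG => //.
  by apply: subset_itvr; rewrite bnd_simp ltW.
- move=> t tx; apply: G0; apply: subset_itvr tx.
  by rewrite bnd_simp ltW.
Qed.

(** The index of the first node beyond t is the index of the interval of the
    partition that contains t. *)
Definition step_fun p c (t : R) : R := c (find (fun x => t < x) p).

Lemma step_funE (a b : R) p c i t : itv_partition a b p -> (i < size p)%N ->
  nth 0 (a :: p) i < t < nth 0 p i -> step_fun p c t = c i.
Proof.
rewrite /step_fun => ap ip ti; congr c.
elim: p a i ap ip ti => // x p IH a [|i] ap /= ip /andP[t1 t2]; first by rewrite t2.
have ip' : (i < (size p).+1)%N by exact: ltnW.
have xt : x < t.
  apply: le_lt_trans t1; rewrite (@set_nth_default _ _ b)//.
  exact: (itv_partition_nth_ge ip' (itv_partition_cons ap)).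
rewrite ltNge (ltW xt)/=.
congr _.+1; apply: (IH x) => //; first exact: itv_partition_cons ap.
by rewrite t1.
Qed.

Lemma measurable_step_fun p c : measurable_fun setT (step_fun p c).
Proof.
elim: p c => [|x p IH] c; first exact: (measurable_cst (c 0%N)).
have -> : step_fun (x :: p) c =
    fun t => if t < x then c 0%N else step_fun p (c \o succn) t.
  by apply/funext => t; rewrite /step_fun/=; case: ifP.
apply: measurable_fun_ifT => //; exact: measurable_fun_ltr.
Qed.

Lemma L2_step_fun (T : R) p c : L2 T (step_fun p c).
Proof.
apply: (@L2_bounded _ _ _ (\sum_(i < (size p).+1) `|c i|)).
  by apply: measurable_funTS; exact: measurable_step_fun.
move=> t _; have := find_size (fun x => t < x) p; rewrite -ltnS => fp.
rewrite /step_fun (bigD1 (Ordinal fp))//= lerDl.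
by apply: sumr_ge0.
Qed.

(** Otherwise G would exceed its average everywhere on (a,b), and the
    difference, although positive, would have integral zero. *)
Lemma exists_le_average (a b : R) G : a < b ->
  measurable_fun `]a, b[%classic G ->
  (forall t, t \in `]a, b[ -> 0 <= G t)%E ->
  exists2 y, y \in `]a, b[ &
    ((b - a)%:E * G y <= \int[mu]_(t in `]a, b[%classic) G t)%E.
Proof.
move=> ab mG G0; apply: contrapT => noy.
have ba0 : 0 < b - a by rewrite subr_gt0.
have gtG y : y \in `]a, b[ ->
    (\int[mu]_(t in `]a, b[%classic) G t < (b - a)%:E * G y)%E.
  by move=> yab; rewrite ltNge; apply/negP => le; apply: noy; exists y.
have muJ := lebesgue_measure_oo ab.
have iG0 : (0 <= \int[mu]_(t in `]a, b[%classic) G t)%E.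
  by apply: integral_ge0 => t; exact: G0.
(* The average is finite, as it lies below some value of G. *)
have [C iG] : exists C, (\int[mu]_(t in `]a, b[%classic) G t = C%:E)%E.
  exists (fine (\int[mu]_(t in `]a, b[%classic) G t)%E); rewrite fineK//.
  rewrite ge0_fin_numE//; apply: lt_le_trans (gtG ((a + b) / 2) _) (leey _).
  by rewrite in_itv/=; apply/andP; split; lra.
have kG y : y \in `]a, b[ -> ((C / (b - a))%:E < G y)%E.
  move=> /gtG; rewrite iG; case: (G y) => [r| |].
  - by rewrite -EFinM !lte_fin ltr_pdivrMr// mulrC.
  - by rewrite ltry.
  - by rewrite mulrNy gtr0_sg// mul1e.
have k0 : 0 <= C / (b - a) by rewrite divr_ge0 ?(ltW ba0)// -lee_fin -iG.
pose H t := (G t - (C / (b - a))%:E)%E.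
have mH : measurable_fun `]a, b[%classic H by apply: emeasurable_funB.
have H0 y : y \in `]a, b[ -> (0 < H y)%E by move=> /kG; rewrite sube_gt0.
have : (\int[mu]_(t in `]a, b[%classic) `|H t| = 0)%E.
  set X := (X in X = 0%E).
  have : (\int[mu]_(t in `]a, b[%classic) (H t + (C / (b - a))%:E) = C%:E)%E.
    rewrite -iG; apply: eq_integral => t _; rewrite /H subeK//.
  have -> : (\int[mu]_(t in `]a, b[%classic) (H t + (C / (b - a))%:E) =
      X + C%:E)%E.
    rewrite ge0_integralD//.
    - congr (_ + _)%E; last by rewrite integral_cst//= muJ -EFinM divfK ?gt_eqF.
      by apply: eq_integral => t /[!inE] /H0/ltW/gee0_abs.
    - by move=> t /H0/ltW.
  have : (0 <= X)%E by exact: integral_ge0.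
  case: X => [r| |]//= _ [] /eqP.
  by rewrite -subr_eq0 addrK => /eqP ->.
move=> HI; have [N [mN N0 JN]] := (ae_eq_integral_abs mu (measurable_itv _) mH).1 HI.
have : (mu (`]a, b[%classic : set R) <= mu N)%E.
  apply: le_measure; rewrite ?inE// => t tab; apply: JN => /= /(_ tab).
  by move=> Ht; have := H0 _ tab; rewrite Ht ltxx.
by rewrite muJ N0 lee_fin leNgt ba0.
Qed.

End Partition.

(** * Local approximation for fractional smoothness *)

Section Slobodeckij.
Context {R : realType}.
Implicit Types (T s a b : R) (f : R -> R).

(** The inner integral of the Slobodeckij seminorm: a density on (0,T) with
    integral [slobodeckij2]. *)
Definition gagliardo T s f (x : R) : \bar R :=
  (\int[mu]_(y in I T) (`|f x - f y| ^+ 2 / `|x - y| `^ (1 + 2 * s))%:E)%E.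

Lemma gagliardo_ge0 T s f x : (0 <= gagliardo T s f x)%E.
Proof.
by apply: integral_ge0 => y _; rewrite lee_fin divr_ge0 ?sqr_ge0 ?powR_ge0.
Qed.

(** By Tonelli, once f is replaced by its extension by zero, for which the
    kernel is measurable on the whole plane. *)
Lemma measurable_gagliardo T s f : measurable_fun (I T) f ->
  measurable_fun (I T) (gagliardo T s f).
Proof.
move=> mf; have mF := (measurable_restrictT f (measurable_itv _)).1 mf.
pose k (z : measurableTypeR R * measurableTypeR R) : \bar R :=
  (`|(f \_ (I T)) z.1 - (f \_ (I T)) z.2| ^+ 2 *
   `|z.1 - z.2| `^ (- (1 + 2 * s)))%:E.
have mk : measurable_fun setT k.
  apply/measurable_EFinP/measurable_funM.
    apply: measurable_funX; apply: measurableT_comp => //.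
    by apply: measurable_funB; apply: measurableT_comp.
  apply: (measurableT_comp (measurable_powR _)).
  by apply: measurableT_comp => //; exact: measurable_funB.
have mkI : measurable_fun setT (k \_ (setT `*` I T)).
  apply: (measurable_restrictT k _).1; first exact: measurableX.
  exact: measurable_funTS.
have kI0 z : (0 <= (k \_ (setT `*` I T)) z)%E.
  rewrite /patch; case: ifP => // _.
  by rewrite lee_fin mulr_ge0 ?sqr_ge0 ?powR_ge0.
have := @measurable_fun_fubini_tonelli_F _ _ (measurableTypeR R)
  (measurableTypeR R) R mu _ mkI kI0.
move=> /(measurable_funTS (D := I T)); apply: eq_measurable_fun => x /[!inE] Ix.
rewrite /gagliardo /fubini_F [RHS]integral_mkcond; apply: eq_integral => y _.
rewrite /patch in_setX in_setT/=; case: ifP => //= yI.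
by rewrite /k/= /patch yI mem_set// powRN.
Qed.

(** The constant is f(y) for a point y at which [gagliardo] is at most its
    average over (a,b).  Since |x - y| < b - a, the integral of |f(x) - f(y)|^2
    is at most (b - a)^(1 + 2s) times [gagliardo] at y, and one factor b - a
    cancels against the average. *)
Lemma slobodeckij_local T s f a b : 0 < s -> measurable_fun (I T) f ->
  0 <= a -> a < b -> b <= T ->
  exists c, (\int[mu]_(x in `]a, b[%classic) ((f x - c) ^+ 2)%:E <=
    ((b - a) `^ (2 * s))%:E *
    \int[mu]_(x in `]a, b[%classic) gagliardo T s f x)%E.
Proof.
move=> s0 mf a0 ab bT.
have JI : `]a, b[%classic `<=` I T.
  by move=> t /=; rewrite !in_itv/= => /andP[at_ tb]; apply/andP; split; lra.
have mfJ : measurable_fun `]a, b[%classic f by apply: measurable_funS mf.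
have mG : measurable_fun `]a, b[%classic (gagliardo T s f).
  by apply: measurable_funS (measurable_gagliardo s mf).
have [y yab Gy] := exists_le_average ab mG (fun t _ => gagliardo_ge0 T s f t).
exists (f y); have l0 : (0 <= ((b - a) `^ (2 * s))%:E)%E.
  by rewrite lee_fin powR_ge0.
apply: le_trans (lee_wpmul2l l0 Gy).
have ba0 : 0 < b - a by rewrite subr_gt0.
rewrite muleA -EFinM -[X in _ * X]powRr1 ?(ltW ba0)// -powRD; last first.
  by apply/implyP => _; rewrite gt_eqF.
set l := (b - a) `^ (2 * s + 1).
have mK : measurable_fun (I T)
    (fun x => (`|f y - f x| ^+ 2 / `|y - x| `^ (1 + 2 * s))%:E).
  apply: (@eq_measurable_fun _ _ _ _ _
    (fun x => (`|f y - f x| ^+ 2 * `|y - x| `^ (- (1 + 2 * s)))%:E)).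
    by move=> x _; rewrite powRN.
  apply/measurable_EFinP/measurable_funM.
    by apply: measurable_funX; apply: measurableT_comp => //;
      apply: measurable_funB.
  apply: (measurableT_comp (measurable_powR _)).
  by apply: measurableT_comp => //; apply: measurable_funB.
have K0 x : (0 <= (`|f y - f x| ^+ 2 / `|y - x| `^ (1 + 2 * s))%:E)%E.
  by rewrite lee_fin divr_ge0 ?sqr_ge0 ?powR_ge0.
apply: (@le_trans _ _ (l%:E * \int[mu]_(x in `]a, b[%classic)
    (`|f y - f x| ^+ 2 / `|y - x| `^ (1 + 2 * s))%:E)%E); last first.
  apply: lee_wpmul2l; first by rewrite lee_fin powR_ge0.
  by apply: ge0_subset_integral.
rewrite -ge0_integralZl_EFin ?powR_ge0//; last exact: measurable_funS mK.
apply: ge0_le_integral => //.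
- by move=> x _; rewrite lee_fin sqr_ge0.
- apply/measurable_EFinP/measurable_funX; exact: measurable_funB.
- by apply: measurable_funeM; exact: measurable_funS mK.
move=> x /= xab; rewrite -EFinM lee_fin.
(* On the diagonal the kernel is a quotient by zero, but the left side is 0. *)
have [->|xy] := eqVneq x y.
  by rewrite subrr expr0n/= mulr_ge0 ?powR_ge0// divr_ge0 ?sqr_ge0 ?powR_ge0.
have yx0 : 0 < `|y - x| by rewrite normr_gt0 subr_eq0 eq_sym.
rewrite -(real_normK (num_real (f x - f y))) distrC mulrA ler_pdivlMr ?powR_gt0//.
rewrite [X in _ <= X]mulrC ler_wpM2l ?sqr_ge0// /l (addrC (2 * s)).
apply: ge0_ler_powR; rewrite ?nnegrE ?normr_ge0 ?(ltW ba0)//.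
  by rewrite addr_ge0// mulr_ge0// ltW.
move: xab yab; rewrite !in_itv/= => /andP[? ?] /andP[? ?].
by rewrite ler_norml; apply/andP; split; lra.
Qed.

End Slobodeckij.

(** * A continuously differentiable step and its derivative *)

Section SmoothStep.
Context {R : realType}.
Implicit Types (x d t : R).

(** Differentiability from a global second-order remainder estimate; it makes a
    separate limit computation at the kink of [pos_part] unnecessary. *)
Lemma is_derive_quadratic_remainder (f : R -> R) (x l C : R) :
  (forall h, `|f (x + h) - f x - l * h| <= C * h ^+ 2) ->
  is_derive x 1 f l.
Proof.
move=> fC; suff cv : h^-1 *: (f (h *: 1 + x) - f x) @[h --> (0 : R)^'] --> l.
  by apply: DeriveDef; [apply: cvgP cv | apply: cvg_lim cv].
apply/cvgrPdist_le => e e0; near=> h.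
have h0 : h != 0 by near: h; exact: nbhs_dnbhs_neq.
have C1 : 0 < `|C| + 1 by rewrite ltr_pwDr.
have he : `|h| <= e / (`|C| + 1) by near: h; apply: dnbhs0_le; rewrite divr_gt0.
have -> : l - h^-1 *: (f (h *: 1 + x) - f x) =
    - (h^-1 * (f (x + h) - f x - l * h)).
  by rewrite /GRing.scale/= mulr1 (addrC h); field.
rewrite normrN normrM normfV ler_pdivrMl ?normr_gt0//.
apply: le_trans (fC h) _; rewrite -real_normK ?num_real// expr2 mulrA mulrC.
rewrite ler_wpM2l//; move: he; rewrite ler_pdivlMr// => he.
apply: le_trans he; rewrite mulrC ler_wpM2l//.
by rewrite (le_trans (ler_norm _))// lerDl.
Unshelve. all: by end_near. Qed.

Definition pos_part x t : R := Num.max (t - x) 0.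

Lemma pos_partE x t : pos_part x t = if x < t then t - x else 0.
Proof.
by rewrite /pos_part maxElt subr_lt0; case: (ltgtP x t) => // ->; rewrite subrr.
Qed.

Lemma is_derive_sqr_pos_part x t :
  is_derive t 1 (fun t => pos_part x t ^+ 2) (2 * pos_part x t).
Proof.
apply: (@is_derive_quadratic_remainder _ _ _ 1) => h; rewrite !pos_partE ler_norml.
by do 2 (case: ltP => ?); apply/andP; split; nra.
Qed.

Lemma continuous_pos_part x : continuous (pos_part x).
Proof.
move=> t; apply: (continuous_max (f := fun t => t - x) (g := cst 0)).
  by apply: continuousB => //; exact: cvg_cst.
exact: cvg_cst.
Qed.

(** A scaled second difference of the functions [pos_part x t ^+ 2]: it rises
    from 0 to 1 on [x, x + d] and its derivative [tent] is continuous.  Only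
    C^1 regularity is asked of test functions. *)
Definition smooth_step x d t : R := 2 / d ^+ 2 *
  (pos_part x t ^+ 2 - 2 * pos_part (x + d / 2) t ^+ 2 + pos_part (x + d) t ^+ 2).

Definition tent x d t : R := 4 / d ^+ 2 *
  (pos_part x t - 2 * pos_part (x + d / 2) t + pos_part (x + d) t).

Lemma is_derive_smooth_step x d t : is_derive t 1 (smooth_step x d) (tent x d t).
Proof.
have H1 := is_derive_sqr_pos_part x t.
have H2 := is_derive_sqr_pos_part (x + d / 2) t.
have H3 := is_derive_sqr_pos_part (x + d) t.
have -> : smooth_step x d = (2 / d ^+ 2) \*: ((fun t => pos_part x t ^+ 2)
    - (2 \*: (fun t => pos_part (x + d / 2) t ^+ 2))
    + (fun t => pos_part (x + d) t ^+ 2)) by [].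
apply: is_derive_eq; rewrite /GRing.scale/= /tent.
by ring.
Qed.

Lemma continuous_tent x d : continuous (tent x d).
Proof.
move=> t; apply: cvgM; first exact: cvg_cst.
apply: cvgD; last exact: continuous_pos_part.
apply: cvgB; first exact: continuous_pos_part.
by apply: cvgM; [exact: cvg_cst|exact: continuous_pos_part].
Qed.

Lemma tent_ge0 x d t : 0 < d -> 0 <= tent x d t.
Proof.
move=> d0; apply: mulr_ge0; first by rewrite divr_ge0 ?sqr_ge0.
by rewrite !pos_partE; do 3 (case: ltP => ?); lra.
Qed.

Lemma tent_out x d t : 0 < d -> ~~ (x < t < x + d) -> tent x d t = 0.
Proof.
move=> d0 out; rewrite /tent (_ : _ + _ = 0) ?mulr0// !pos_partE.
move: out; rewrite negb_and -!leNgt => /orP[]?;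
  by do 3 (case: ltP => ?); lra.
Qed.

Lemma smooth_step_le x d t : 0 < d -> t <= x -> smooth_step x d t = 0.
Proof.
move=> d0 tx; rewrite /smooth_step (_ : _ + _ = 0) ?mulr0// !pos_partE.
by do 3 (case: ltP => ?); nra.
Qed.

Lemma smooth_step_ge x d t : 0 < d -> x + d <= t -> smooth_step x d t = 1.
Proof.
move=> d0 tx; rewrite /smooth_step (_ : _ + _ = d ^+ 2 / 2) ?pos_partE; last first.
  by do 3 (case: ltP => ?); nra.
by field; rewrite gt_eqF.
Qed.

Lemma smooth_step_01 x d t : 0 < d -> 0 <= smooth_step x d t <= 1.
Proof.
move=> d0; have d20 : 0 < d ^+ 2 by rewrite exprn_gt0.
rewrite /smooth_step mulrAC ler_pdivrMr// divr_ge0 ?(ltW d20)//= ?mul1r !pos_partE;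
  by do 3 (case: ltP => ?); nra.
Qed.

Lemma integral_tent x d : 0 < d ->
  (\int[mu]_(t in `]x, (x + d)%R[%classic) (tent x d t)%:E = 1)%E.
Proof.
move=> d0; have mt : measurable_fun `]x, (x + d)[%classic (EFin \o tent x d).
  apply/measurable_EFinP; apply: measurable_funTS.
  by apply: continuous_measurable_fun; exact: continuous_tent.
transitivity (\int[mu]_(t in `[x, (x + d)%R]%classic) (tent x d t)%:E)%E.
  exact/esym/(@integral_itv_bndoo _ _ _ (EFin \o tent x d)).
rewrite (@continuous_FTC2 _ (tent x d) (smooth_step x d)) ?ltrDl//.
- by rewrite smooth_step_ge ?lexx// smooth_step_le// sube0.
- by apply: continuous_subspaceT; exact: continuous_tent.
- have cs t : {for t, continuous (smooth_step x d)}.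
    apply: differentiable_continuous; apply/derivable1_diffP.
    by case: (is_derive_smooth_step x d t).
  split.
  + by move=> t _; case: (is_derive_smooth_step x d t).
  + by apply: cvg_at_right_filter; exact: cs.
  + by apply: cvg_at_left_filter; exact: cs.
- move=> t _; rewrite derive1E.
  exact: (@derive_val _ _ _ _ _ _ _ (is_derive_smooth_step x d t)).
Qed.

End SmoothStep.

(** * Local approximation for functions with a weak derivative *)

Section WeakDerivative.
Context {R : realType}.
Implicit Types (T a b x y d c : R) (f g w : R -> R).

Lemma L2_smooth_step T x d : 0 < d -> L2 T (smooth_step x d).
Proof.
move=> d0; apply: (@L2_bounded _ _ _ 1).
  apply: measurable_funTS; apply: continuous_measurable_fun => t.
  apply: differentiable_continuous; apply/derivable1_diffP.
  by case: (is_derive_smooth_step x d t).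
by move=> t _; have /andP[? ?] := smooth_step_01 x t d0; rewrite ger0_norm.
Qed.

Lemma measurable_tent x d : measurable_fun setT (tent x d).
Proof. by apply: continuous_measurable_fun; exact: continuous_tent. Qed.

Lemma L2_tent T x d : 0 < d -> L2 T (tent x d).
Proof.
move=> d0; apply: (@L2_bounded _ _ _ (4 / d ^+ 2 * d)).
  by apply: measurable_funTS; exact: measurable_tent.
move=> t _; rewrite ger0_norm ?tent_ge0//.
have [tx|/tent_out->//] := boolP (x < t < x + d); last first.
  by rewrite mulr_ge0// ?divr_ge0 ?sqr_ge0// ltW.
apply: ler_wpM2l; first by rewrite divr_ge0 ?sqr_ge0.
by move: tx => /andP[? ?]; rewrite !pos_partE; do 3 (case: ltP => ?); lra.
Qed.

Lemma Rintegral_tent T x d : 0 < d -> 0 <= x -> x + d <= T ->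
  \int[mu]_(t in I T) tent x d t = 1.
Proof.
move=> d0 x0 xT; rewrite /Rintegral -[RHS]/(fine 1%E) -(integral_tent x d0).
congr fine; rewrite [LHS]integral_mkcond [RHS]integral_mkcond.
apply: eq_integral => t _; rewrite /patch.
have [xd|xd] := boolP (x < t < x + d).
  rewrite !mem_set//= in_itv/=; move: xd => /andP[xt td].
  by rewrite (le_lt_trans x0 xt) (lt_le_trans td xT).
rewrite [in RHS]memNset//= ?in_itv; last exact/negP.
by rewrite tent_out// if_same.
Qed.

(** By [Rintegral_tent], [tent x d] is a probability density on (x, x + d), so
    integrating against it is averaging over this interval. *)
Lemma tent_average T x d c e g : 0 < d -> 0 <= x -> x + d <= T -> L2 T g ->
  (forall t, x < t < x + d -> `|g t - c| <= e) ->
  `|\int[mu]_(t in I T) (g t * tent x d t) - c| <= e.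
Proof.
move=> d0 x0 xT Lg ge; have Lt := L2_tent T x d0.
have Lc : L2 T (cst c) by apply: (@L2_bounded _ _ _ `|c|).
have L1 : L2 T (cst 1) by apply: (@L2_bounded _ _ _ 1) => // t _; rewrite normr1.
have Lgc := L2B Lg Lc.
have it : mu.-integrable (I T) (EFin \o tent x d).
  by have := L2_integrableM L1 Lt; apply: eq_integrable => // t _ /=; rewrite mul1r.
have -> : \int[mu]_(t in I T) (g t * tent x d t) - c =
    \int[mu]_(t in I T) ((g t - c) * tent x d t).
  rewrite -[X in _ - X]mulr1 -(Rintegral_tent d0 x0 xT) -RintegralZl//.
  rewrite -RintegralB//; first by apply: eq_Rintegral => t _; rewrite mulrBl.
  - exact: L2_integrableM.
  - exact: (L2_integrableM Lc Lt).
apply: le_trans (le_normr_Rintegral _ (L2_integrableM Lgc Lt)) _ => //.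
rewrite -[X in _ <= X]mulr1 -(Rintegral_tent d0 x0 xT) -RintegralZl//.
apply: le_Rintegral => //.
- by have := integrable_norm (L2_integrableM Lgc Lt).
- have := L2_integrableM (@L2_bounded _ T (cst e) `|e| _ _) Lt; exact.
move=> t _; rewrite normrM (ger0_norm (tent_ge0 _ _ d0)).
have [td|/tent_out->//] := boolP (x < t < x + d); last by rewrite !mulr0.
by rewrite ler_wpM2r ?tent_ge0// ge.
Qed.

(** These test functions approximate the indicator function of (x,y) as d tends
    to 0, and their derivatives the difference of the point masses at x and y. *)
Lemma test_function_smooth_step T x y d : 0 < d -> 0 < x -> x < y -> y + d < T ->
  test_function T (fun t => smooth_step x d t - smooth_step y d t) /\
  derive1 (fun t => smooth_step x d t - smooth_step y d t) =
    (fun t => tent x d t - tent y d t).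
Proof.
move=> d0 x0 xy yT; set phi := fun t => _.
have dphi (t : R) : is_derive t 1 phi (tent x d t - tent y d t).
  have H1 := is_derive_smooth_step x d t; have H2 := is_derive_smooth_step y d t.
  have -> : phi = smooth_step x d - smooth_step y d by [].
  exact: is_deriveB.
have dE : derive1 phi = (fun t => tent x d t - tent y d t).
  by apply/funext => t; rewrite derive1E; exact: (@derive_val _ _ _ _ _ _ _ (dphi t)).
split => //; split.
- by move=> t; case: (dphi t).
- by rewrite dE => t; apply: cvgB; exact: continuous_tent.
exists x, (y + d); split => // t; rewrite in_itv/= negb_and -!ltNge /phi.
move=> /orP[tx|td].
  by rewrite !smooth_step_le ?subrr// ltW// (lt_trans tx).
by rewrite !smooth_step_ge ?subrr// ltW// (le_lt_trans _ td)// lerD2r ltW.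
Qed.

Lemma integrable_patch T (J : set R) f : measurable J ->
  mu.-integrable (I T) (EFin \o f) ->
  mu.-integrable (I T) (EFin \o (f \_ J)).
Proof.
move=> mJ fI; rewrite -restrict_EFin; apply/integrable_restrict => //.
by apply: integrableS fI => //; exact: measurableI.
Qed.

(** The left side is the square of the integral of w phi, and phi, being bounded
    by 1 with support in (a,b), has squared L^2 norm at most b - a. *)
Lemma weak_derivative_test_le T a b f w phi : 0 <= a -> a < b -> b <= T ->
  is_weak_derivative T f w -> test_function T phi -> L2 T phi ->
  (forall t, `|phi t| <= 1) -> (forall t, t \notin `]a, b[ -> phi t = 0) ->
  (\int[mu]_(t in I T) (f t * derive1 phi t)) ^+ 2 <=
  (b - a) * \int[mu]_(t in `]a, b[%classic) (w t ^+ 2).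
Proof.
move=> a0 ab bT [Lw wd] tphi Lphi phi1 phi0; rewrite (wd _ tphi) sqrrN.
have JI t : `]a, b[%classic t -> I T t.
  by rewrite /= !in_itv/= => /andP[? ?]; apply/andP; split; lra.
(* Cutting w off outside (a,b) does not change its product with phi. *)
pose u := w \_ `]a, b[%classic.
have u2 : (fun t => u t ^+ 2) = (fun t => w t ^+ 2) \_ `]a, b[%classic.
  by apply/funext => t; rewrite /u /patch; case: ifP; rewrite // expr0n.
have restr (h : R -> R) : \int[mu]_(t in `]a, b[%classic) h t =
    \int[mu]_(t in I T) (h \_ `]a, b[%classic) t.
  rewrite -Rintegral_mkcondr; congr (Rintegral mu _ _).
  by apply/seteqP; split => [t tJ|t []//]; split => //; exact: JI.
have Lu : L2 T u.
  apply/L2P; split.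
    apply/(measurable_restrict w) => //.
    by apply: measurable_funS (L2_measurable Lw) => //; exact: subIsetl.
  by rewrite u2; apply: integrable_patch => //; exact: L2_integrable_sq.
rewrite restr -u2.
have -> : \int[mu]_(t in I T) (w t * phi t) = \int[mu]_(t in I T) (u t * phi t).
  apply: eq_Rintegral => t _; rewrite /u /patch; case: ifPn => // tJ.
  by rewrite phi0 ?mulr0//; apply: contra tJ => tJ; rewrite inE.
apply: L2_cauchy_schwarz => //; first by rewrite subr_gt0.
have -> : b - a = \int[mu]_(t in I T) ((cst (1 : R)) \_ `]a, b[%classic) t.
  rewrite -restr Rintegral_cst// mul1r.
  by rewrite -[LHS]/(fine (b - a)%:E) -(lebesgue_measure_oo ab).
apply: le_Rintegral => //; first exact: L2_integrable_sq.
- apply: integrable_patch => //.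
  apply: measurable_bounded_integrable => //; first exact: measure_itv_lty.
  by exists 1; split => // z z1 t _ /=; rewrite normr1 ltW.
- move=> t _; rewrite /patch; case: ifPn => tJ.
    by rewrite -real_normK ?num_real// expr_le1.
  by rewrite phi0 ?expr0n//; apply: contra tJ => tJ; rewrite inE.
Qed.

(** Hoelder continuity of the continuous representative g.  Tested with the
    function of [test_function_smooth_step], the integral of f phi' is a
    difference of two averages of g, which tends to g(x) - g(y) as d tends to 0,
    while [weak_derivative_test_le] bounds it uniformly in d. *)
Lemma weak_derivative_hoelder T a b f g w x y : 0 <= a -> b <= T ->
  is_weak_derivative T f w -> L2 T f ->
  {within `[0, T], continuous g} -> f = g %[ae mu in I T] ->
  a < x -> x < y -> y < b ->
  (g x - g y) ^+ 2 <= (b - a) * \int[mu]_(t in `]a, b[%classic) (w t ^+ 2).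
Proof.
move=> a0 bT fw Lf cg fg ax xy yb.
have Lg : L2 T g.
  apply: L2_ae fg Lf.
  have mg := subspace_continuous_measurable_fun (measurable_itv `[0, T]) cg.
  apply: measurable_funS mg => //; exact: subset_itv_oo_cc.
have gx z : a < z -> z < b -> {for z, continuous g}.
  move=> az zb; have T0 : 0 < T by lra.
  have [+ _ _] := (continuous_within_itvP g T0).1 cg.
  by apply; rewrite in_itv/=; apply/andP; split; lra.
set M := _ * _.
have M0 : 0 <= M.
  rewrite mulr_ge0 ?subr_ge0//; first lra.
  by apply: Rintegral_ge0 => t _; exact: sqr_ge0.
suff H : `|g x - g y| <= Num.sqrt M.
  by rewrite -real_normK ?num_real// -(sqr_sqrtr M0) lerXn2r// nnegrE sqrtr_ge0.
apply/ler_addgt0Pr => e e0.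
have e20 : 0 < e / 2 by rewrite divr_gt0.
have near_le z : a < z -> z < b ->
    exists2 r, 0 < r & forall t, z < t < z + r -> `|g t - g z| <= e / 2.
  move=> az zb; have /cvgrPdist_le /(_ _ e20) := gx z az zb.
  move=> /nbhs_ballP[r /= r0 rb]; exists r => // t /andP[zt tr].
  rewrite distrC; apply: rb; rewrite /ball/= ltr_distlC; apply/andP; split; lra.
have [r1 r10 H1] := near_le x ax (lt_trans xy yb).
have [r2 r20 H2] := near_le y (lt_trans ax xy) yb.
(* The support of the test function must end before b. *)
pose d := Num.min (Num.min r1 r2) ((b - y) / 2).
have d0 : 0 < d by rewrite !lt_min r10 r20/= divr_gt0// subr_gt0.
have dr1 : d <= r1 by rewrite !ge_min lexx.
have dr2 : d <= r2 by rewrite !ge_min lexx orbT.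
have dby : d <= (b - y) / 2 by rewrite !ge_min lexx !orbT.
have Ltx := L2_tent T x d0; have Lty := L2_tent T y d0.
have [tphi dphi] :=
  @test_function_smooth_step T x y d d0 (le_lt_trans a0 ax) xy ltac:(lra).
set phi := (fun t => smooth_step x d t - smooth_step y d t) in tphi dphi.
have phi1 t : `|phi t| <= 1.
  have /andP[? ?] := smooth_step_01 x t d0; have /andP[? ?] := smooth_step_01 y t d0.
  by rewrite /phi ler_norml; apply/andP; split; lra.
have phi0 t : t \notin `]a, b[ -> phi t = 0.
  rewrite in_itv/= negb_and -!leNgt /phi => /orP[ta|bt].
    by rewrite !smooth_step_le ?subrr//; lra.
  by rewrite !smooth_step_ge ?subrr//; lra.
have Lphi : L2 T phi by apply: L2B; exact: L2_smooth_step.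
have ab : a < b by lra.
have := weak_derivative_test_le a0 ab bT fw tphi Lphi phi1 phi0.
rewrite -/M => PM.
have {PM} : `|\int[mu]_(t in I T) (f t * derive1 phi t)| <= Num.sqrt M.
  by rewrite -sqrtr_sqr ler_wsqrtr.
rewrite dphi (L2_Rintegral_ae Lf Lg _ fg); last exact: L2B.
have -> : \int[mu]_(t in I T) (g t * (tent x d t - tent y d t)) =
    \int[mu]_(t in I T) (g t * tent x d t) -
    \int[mu]_(t in I T) (g t * tent y d t).
  rewrite -RintegralB//; [|exact: L2_integrableM|exact: L2_integrableM].
  by apply: eq_Rintegral => t _; rewrite mulrBr.
have A1 : `|\int[mu]_(t in I T) (g t * tent x d t) - g x| <= e / 2.
  apply: tent_average => //; try lra.
  by move=> t /andP[? ?]; apply: H1; apply/andP; split; lra.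
have A2 : `|\int[mu]_(t in I T) (g t * tent y d t) - g y| <= e / 2.
  apply: tent_average => //; try lra.
  by move=> t /andP[? ?]; apply: H2; apply/andP; split; lra.
move: A1 A2; rewrite !ler_norml => /andP[? ?] /andP[? ?] /andP[? ?].
by apply/andP; split; lra.
Qed.

(** Poincare inequality, with the value of the continuous representative at the
    midpoint as constant: [weak_derivative_hoelder] bounds |g - g(m)|^2 pointwise,
    and integrating over (a,b) contributes the second factor b - a. *)
Lemma weak_derivative_local T a b f g w : 0 <= a -> a < b -> b <= T ->
  is_weak_derivative T f w -> L2 T f ->
  {within `[0, T], continuous g} -> f = g %[ae mu in I T] ->
  exists c, (\int[mu]_(x in `]a, b[%classic) ((f x - c) ^+ 2)%:E <=
    ((b - a) `^ (2 * 1))%:E *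
    \int[mu]_(x in `]a, b[%classic) (w x ^+ 2)%:E)%E.
Proof.
move=> a0 ab bT fw Lf cg fg; have ba0 : 0 < b - a by rewrite subr_gt0.
have JI : `]a, b[%classic `<=` I T.
  by move=> t /=; rewrite !in_itv/= => /andP[? ?]; apply/andP; split; lra.
have iw : mu.-integrable `]a, b[%classic (EFin \o (fun t => w t ^+ 2)).
  by apply: integrableS (L2_integrable_sq fw.1).
pose m := (a + b) / 2; exists (g m).
set W := \int[mu]_(t in `]a, b[%classic) (w t ^+ 2).
have -> : (\int[mu]_(x in `]a, b[%classic) (w x ^+ 2)%:E = W%:E)%E.
  by rewrite /W /Rintegral fineK//; exact: integrable_fin_num iw.
have gW x : a < x -> x < b -> (g x - g m) ^+ 2 <= (b - a) * W.
  move=> ax xb; have [xm|mx|->] := ltgtP x m.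
  - by apply: (weak_derivative_hoelder _ _ fw) => //; rewrite /m; lra.
  - rewrite -sqrrN opprB.
    by apply: (weak_derivative_hoelder _ _ fw) => //; rewrite /m; lra.
  - rewrite subrr expr0n/= mulr_ge0 ?(ltW ba0)//.
    by apply: Rintegral_ge0 => t _; exact: sqr_ge0.
apply: (@le_trans _ _ (\int[mu]_(x in `]a, b[%classic) ((b - a) * W)%:E)%E).
  apply: ae_ge0_le_integral => //.
  - by move=> x _; rewrite lee_fin sqr_ge0.
  - apply/measurable_EFinP/measurable_funX/measurable_funB => //.
    exact: measurable_funS (L2_measurable Lf).
  - move=> x _; rewrite lee_fin mulr_ge0 ?(ltW ba0)//.
    by apply: Rintegral_ge0 => t _; exact: sqr_ge0.
  - move: fg; rewrite -[X in X -> _]/(ae_eq mu (I T) f g).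
    apply: filterS => x fgx xJ; rewrite lee_fin fgx; last exact: JI.
    by move: xJ; rewrite /= in_itv/= => /andP[? ?]; exact: gW.
rewrite integral_cst//= lebesgue_measure_oo// -!EFinM lee_fin mulr1.
by rewrite powR_mulrn ?(ltW ba0)// expr2 mulrAC.
Qed.

End WeakDerivative.

(** * Piecewise constant approximation on a mesh *)

Section Approximation.
Context {R : realType}.
Implicit Types (T s : R) (f : R -> R) (p : seq R).

(** The three kinds of Sobolev norm in one form.  A density G, rather than a
    seminorm for each interval, is what makes the local bounds add up: the
    integrals of G over the intervals of a mesh sum to its integral over (0,T). *)
Lemma local_energy T s f : 0 <= s <= 1 -> L2 T f ->
  (s = 1 -> H1 T f /\ vanishes_at0 T f) ->
  exists G : R -> \bar R, [/\ measurable_fun (I T) G, (forall x, 0 <= G x)%E,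
    (\int[mu]_(x in I T) G x <= Hsnorm T s f ^+ 2)%E &
    forall a b, 0 <= a -> a < b -> b <= T ->
    exists c, (\int[mu]_(x in `]a, b[%classic) ((f x - c) ^+ 2)%:E <=
      ((b - a) `^ (2 * s))%:E * \int[mu]_(x in `]a, b[%classic) G x)%E].
Proof.
move=> /andP[s0 s1] Lf f1; have mf := L2_measurable Lf.
have msq (g : R -> R) : measurable_fun (I T) g ->
    measurable_fun (I T) (fun x => (g x ^+ 2)%:E).
  by move=> mg; apply/measurable_EFinP/measurable_funX.
have sq0 (g : R -> R) x : (0 <= (g x ^+ 2 : R)%:E)%E by rewrite lee_fin sqr_ge0.
rewrite /Hsnorm; have [->|sn0] := eqVneq s 0.
  exists (fun x => (f x ^+ 2)%:E); split => //.
  - exact: msq.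
  - by rewrite L2norm_sq.
  - move=> a b _ _ _; exists 0; rewrite mulr0 powRr0 mul1e.
    by under eq_integral do rewrite subr0.
have [s1E|sn1] := eqVneq s 1.
  have [[_ fw] [g [cg fg _]]] := f1 s1E; rewrite s1E.
  have dw : is_weak_derivative T f (weak_derivative T f) by exact: xgetPex fw.
  exists (fun x => (weak_derivative T f x ^+ 2)%:E); split.
  - by apply: msq; exact: L2_measurable dw.1.
  - by move=> x; exact: sq0.
  - by rewrite sqr_poweR_inv2 ?adde_ge0 ?sqre_ge0// -L2norm_sq leeDr ?sqre_ge0.
  - by move=> a b a0 ab bT; exact: (weak_derivative_local a0 ab bT dw Lf cg fg).
exists (gagliardo T s f); split.
- exact: measurable_gagliardo.
- by move=> x; exact: gagliardo_ge0.
- have sl0 : (0 <= slobodeckij2 T s f)%E.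
    by apply: integral_ge0 => x _; exact: gagliardo_ge0.
  rewrite -[X in (X <= _)%E]/(slobodeckij2 T s f).
  by rewrite (sqr_poweR_inv2 (adde_ge0 (sqre_ge0 _) sl0)) leeDr ?sqre_ge0.
- by move=> a b a0 ab bT; apply: slobodeckij_local => //; rewrite lt_def sn0.
Qed.

(** [local_energy] on each interval of the mesh, summed with
    [ge0_integral_partition]. *)
Lemma piecewise_constant_approximation T s f p h : 0 <= s <= 1 -> L2 T f ->
  (s = 1 -> H1 T f /\ vanishes_at0 T f) ->
  itv_partition 0 T p -> meshwidth p <= h ->
  exists q, [/\ L2 T q, piecewise_constant p q &
    (\int[mu]_(x in I T) ((f x - q x) ^+ 2)%:E <=
     (h `^ (2 * s))%:E * Hsnorm T s f ^+ 2)%E].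
Proof.
move=> s01 Lf f1 pT ph; have [G [mG G0 iG locG]] := local_energy s01 Lf f1.
have s0 : 0 <= s by case/andP: s01.
have node i : (i < size p)%N ->
    [/\ 0 <= left_node p i, left_node p i < right_node p i & right_node p i <= T].
  move=> ip; rewrite /left_node /right_node; split.
  - rewrite (@set_nth_default _ _ T) ?ltnS ?(ltnW ip)//.
    exact: (itv_partition_nth_ge (ltnW ip) pT).
  - by case: pT => /(pathP 0) pp _; exact: pp.
  - rewrite (@set_nth_default _ _ T)//.
    exact: (itv_partition_nth_le (m := i.+1) ip pT).
have /choice[c cP] : forall i, exists ci : R, (i < size p)%N ->
    (\int[mu]_(x in `]left_node p i, right_node p i[%classic)
      ((f x - ci) ^+ 2)%:E <=
     ((right_node p i - left_node p i) `^ (2 * s))%:E *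
     \int[mu]_(x in `]left_node p i, right_node p i[%classic) G x)%E.
  move=> i; have [ip|_] := boolP (i < size p)%N; last by exists 0.
  by have [l0 lr rT] := node _ ip; have [ci Hci] := locG _ _ l0 lr rT; exists ci.
have qE i t : (i < size p)%N -> left_node p i < t < right_node p i ->
    step_fun p c t = c i.
  by move=> ip; exact: (step_funE c pT ip).
have Lq : L2 T (step_fun p c) by exact: L2_step_fun.
exists (step_fun p c); split => //.
  by move=> i ip; exists (c i) => t; exact: qE.
have mfq : measurable_fun (I T) (fun x => ((f x - step_fun p c x) ^+ 2)%:E).
  by apply/measurable_EFinP/measurable_funX/measurable_funB; exact: L2_measurable.
apply: le_trans (lee_wpmul2l _ iG); last by rewrite lee_fin powR_ge0.
rewrite (ge0_integral_partition pT mfq); last first.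
  by move=> t _; rewrite lee_fin sqr_ge0.
rewrite (ge0_integral_partition pT mG) ?ge0_sume_distrr//; last first.
  by move=> i _; exact: integral_ge0.
apply: lee_sum => -[i ip] _ /=.
rewrite -[nth 0%R (0 :: p) i]/(left_node p i) -[nth 0%R p i]/(right_node p i).
have [l0 lr rT] := node _ ip.
under eq_integral => t /[!inE] ti do rewrite (qE i t ip ti).
apply: le_trans (cP _ ip) _; apply: lee_wpmul2r; first exact: integral_ge0.
rewrite lee_fin; have rlh : right_node p i - left_node p i <= h.
  apply: le_trans ph; rewrite /meshwidth.
  exact: (le_bigmax _
    (fun i : 'I_(size p) => right_node p i - left_node p i) (Ordinal ip)).
apply: ge0_ler_powR; rewrite ?nnegrE ?mulr_ge0 ?subr_ge0 ?(ltW lr)//.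
by rewrite (le_trans _ rlh)// subr_ge0 ltW.
Qed.

End Approximation.

(** * Galerkin orthogonality and the error estimate *)

Section Galerkin.
Context {R : realType}.
Implicit Types (L T : R) (u v q : fSigma R).

Lemma innerS_Aop L T v q : 0 <= L -> L2S T v -> L2S T q ->
  L2S T (Aop L v) /\
  innerS T (Aop L v) q = - 2^-1 * innerS T (v + delay L v) q.
Proof.
move=> L0 Lv Lq; have [B1 B2] := L2S_D Lv (L2S_delay L0 Lv).
have [q1 q2] := Lq.
have -> : Aop L v = ((fun t => - 2^-1 * (v + delay L v).1 t),
                     (fun t => - 2^-1 * (v + delay L v).2 t)).
  by congr pair; apply/funext => t; rewrite /= mulrDr.
split; first by split; exact: L2Z.
rewrite /innerS mulrDr -!RintegralZl//; try exact: L2_integrableM.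
by congr (_ + _); apply: eq_Rintegral => t _; rewrite mulrA.
Qed.

(** The exact and the discrete equation subtracted, with the factor -1/2
    removed. *)
Lemma galerkin_orthogonality L T g z zh q : 0 <= L ->
  L2S T g -> L2S T z -> L2S T zh -> L2S T q -> eqS T (Aop L z) g ->
  innerS T (Aop L zh) q = innerS T g q ->
  innerS T ((z - zh) + delay L (z - zh)) q = 0.
Proof.
move=> L0 Lg Lz Lzh Lq zg zhg; have Le := L2S_B Lz Lzh.
have [LAz Az] := innerS_Aop L0 Lz Lq; have [_ Azh] := innerS_Aop L0 Lzh Lq.
have eqB : innerS T (z + delay L z) q = innerS T (zh + delay L zh) q.
  apply: (@mulfI _ (- 2^-1 : R)); first by rewrite oppr_eq0 invr_eq0 pnatr_eq0.
  by rewrite -Az -Azh zhg (innerS_ae LAz Lg Lq zg).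
have L2B v : L2S T v -> L2S T (v + delay L v).
  by move=> Lv; apply: L2S_D => //; exact: L2S_delay.
have zE : z + delay L z = (z - zh + delay L (z - zh)) + (zh + delay L zh).
  by rewrite addrACA -delayD subrK.
move/eqP: eqB; rewrite zE (innerSDl (L2B _ Le) (L2B _ Lzh) Lq) -subr_eq0 addrK.
by move/eqP.
Qed.

End Galerkin.

Unset Implicit Arguments.

Theorem corollary5p3 (R : realType) (L T s : R)
    (L_gt0 : 0 < L) (T_gt0 : 0 < T) (s01 : 0 <= s <= 1) :
  exists c0 : R, 0 < c0 /\
    forall p0 pL : seq R, itv_partition 0 T p0 -> itv_partition 0 T pL ->
    forall g z zh : fSigma R,
      L2S T g ->
      L2S T z -> eqS T (Aop L z) g ->
      Hs0S T s z ->
      S0S T p0 pL zh ->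
      (forall qh, S0S T p0 pL qh -> innerS T (Aop L zh) qh = innerS T g qh) ->
      (L2normS T (z - zh) <= (c0 * meshwidthS p0 pL `^ s)%:E * HsnormS T s z)%E.
Proof.
have [C [C0 HC]] := quasi_optimality L_gt0 T_gt0.
exists (Num.sqrt C); split; first by rewrite sqrtr_gt0.
move=> p0 pL p0T pLT g z zh Lg Lz zg Hz [Lzh zh0 zhL] galerkin.
have z1 : s = 1 -> [/\ H1 T z.1, H1 T z.2, vanishes_at0 T z.1 & vanishes_at0 T z.2].
  by move=> s1; move: Hz; rewrite s1 /Hs0S oner_eq0 eqxx.
set h := meshwidthS p0 pL.
have h0 : meshwidth p0 <= h by rewrite /h /meshwidthS le_max lexx.
have hL : meshwidth pL <= h by rewrite /h /meshwidthS le_max lexx orbT.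
have [q0 [Lq0 pq0 aq0]] := piecewise_constant_approximation s01 Lz.1
  (fun s1 => let: And4 a _ b _ := z1 s1 in conj a b) p0T h0.
have [qL [LqL pqL aqL]] := piecewise_constant_approximation s01 Lz.2
  (fun s1 => let: And4 _ a _ b := z1 s1 in conj a b) pLT hL.
pose q : fSigma R := (q0, qL).
have Lq : L2S T q by [].
have Le := L2S_B Lz Lzh; have Lr := L2S_B Lz Lq.
have S0q : S0S T p0 pL (q - zh).
  split; first exact: L2S_B.
  - move=> i ip; have [c1 H1] := pq0 i ip; have [c2 H2] := zh0 i ip.
    by exists (c1 - c2) => t ti; rewrite -(H1 t ti) -(H2 t ti).
  - move=> i ip; have [c1 H1] := pqL i ip; have [c2 H2] := zhL i ip.
    by exists (c1 - c2) => t ti; rewrite -(H1 t ti) -(H2 t ti).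
have : innerS T (z - zh) (z - zh) <= C * innerS T (z - q) (z - q).
  apply: HC => //; have -> : z - zh - (z - q) = q - zh.
    by rewrite opprB addrC addrA subrK.
  have [LS _ _] := S0q.
  apply: (galerkin_orthogonality (g := g)) => //; [exact: ltW|exact: galerkin].
rewrite -lee_fin EFinM -!L2normS_sq// => cea.
have c0h : (0 <= (Num.sqrt C * h `^ s)%:E)%E.
  by rewrite lee_fin mulr_ge0 ?sqrtr_ge0 ?powR_ge0.
(* The squared estimate, with c0^2 = C; this also covers an infinite norm of z. *)
rewrite -lee_sqr ?poweR_ge0//; last first.
  by rewrite mule_ge0// poweR_ge0.
apply: le_trans cea _.
rewrite [X in (_ <= X)%E]expe2 muleACA -!expe2 -EFin_expe exprMn.
rewrite sqr_sqrtr ?(ltW C0)//.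
rewrite EFinM -muleA; apply: lee_wpmul2l; first by rewrite lee_fin ltW.
rewrite /L2normS /HsnormS !sqr_poweR_inv2 ?adde_ge0 ?sqre_ge0// !L2norm_sq.
rewrite ge0_muleDr ?sqre_ge0//.
have -> : (h `^ s) ^+ 2 = h `^ (2 * s).
  by rewrite -powR_mulrn ?powR_ge0// -powRrM mulrC.
by apply: leeD; [exact: aq0|exact: aqL].
Qed.
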